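(* For every integer $n\ge 0$, the following three identities hold: $$\sum_{k=0}^{n}\frac{1}{2^{4k}(2k+1)(n-k+1)^2}\,\frac{\binom{2k}{k}}{\binom{2(n-k+1)}{n-k+1}}=\frac{3[(2n+1)!!]^2}{2^{2n+3}(2n+3)!}\left[\pi^2-2\psi'\left(n+\frac{3}{2}\right)\right],$$ $$\sum_{k=0}^{n}\frac{1}{2^{4k}(n-k+1)^2}\,\frac{\binom{2k}{k}}{\binom{2(n-k+1)}{n-k+1}}=\frac{[(2n+1)!!]^2}{2^{2n+3}(2n+2)!}\left[\pi^2-2\psi'\left(n+\frac{3}{2}\right)\right],$$ and $$\sum_{k=0}^{n}\frac{1}{2^{4k}(2k+1)(n-k+1)}\,\frac{\binom{2k}{k}}{\binom{2(n-k+1)}{n-k+1}}=\frac{[(2n+1)!!]^2}{2^{2n+3}(2n+2)!}\left[\pi^2-2\psi'\left(n+\frac{3}{2}\right)\right].$$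
   Context: Here $\psi(x)=[\ln\Gamma(x)]'=\frac{\Gamma'(x)}{\Gamma(x)}$ is the digamma function, the logarithmic derivative of the classical Euler gamma function $\Gamma(z)=\int_0^{\infty}t^{z-1}e^{-t}\,dt$ for $\Re(z)>0$, and $\psi'$ is its derivative (the trigamma function). The double factorial is $(2n+1)!!=1\cdot 3\cdot 5\cdots(2n+1)$. *)

(* Defs.v *)
(* Classical real numbers of Stdlib, with Coquelicot for calculus. *)
From Stdlib Require Import Reals.
From Coquelicot Require Import Coquelicot.

Open Scope R_scope.

(* Euler's integral on the real half-line x > 0, the only part of its domain
   that is used; it is improper at both ends. For t > 0, Rpower t (x - 1) is
   the usual real power. *)
Definition Gamma (x : R) : R :=
  RInt_gen (fun t => Rpower t (x - 1) * exp (- t))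
    (at_right 0) (Rbar_locally p_infty).

Definition digamma (x : R) : R := Derive (fun y => ln (Gamma y)) x.

Definition trigamma (x : R) : R := Derive digamma x.

Fixpoint double_fact (n : nat) : nat :=
  match n with
  | 0%nat | 1%nat => 1%nat
  | S (S m) => (n * double_fact m)%nat
  end.

(* Main.v *)
(** Write [S n] for the sum of [1 / (2k+1)^2] over [k <= n].  The coefficients
    [C(2k,k) / 4^k] and [4^m / (2 m^2 C(2m,m))] are those of [1 / sqrt (1 - x^2)]
    and [asin^2 x], so the three sums are Taylor coefficients of products of such
    series.  Creative telescoping gives the last two sums the same first-order
    recurrence, solved by a multiple of [S n], and the identity
    [2m = (2n+3) - (2k+1)] for [m = n - k + 1] reduces the first sum to them.

    It remains to see that [PI^2 - 2 trigamma (n + 3/2) = 8 S n].  The inequality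
    [Gamma (y+s) <= y^s Gamma y] for [0 <= s <= 1] (weighted AM-GM under the
    integral) and the functional equation give Gauss's limit for [ln Gamma];
    differentiating it twice, by uniform convergence, gives [trigamma x] as the sum
    of [1 / (x+k)^2].  The limit [PI^2 / 8] of [S n] follows from
    [1 / sin^2 x - 1 <= 1 / x^2 <= 1 / sin^2 x] at the points
    [(2k+1) PI / 2^(n+2)], where [1 / sin^2] sums to [2 * 4^n] by angle doubling. *)
Require Import Defs.
From Stdlib Require Import Reals Factorial Lra Lia PSeries_reg Ranalysis5.
From Coquelicot Require Import Coquelicot.

Open Scope R_scope.

(** * The finite sums *)

Lemma sum_f_R0_telescope (G : nat -> R) (n : nat) :
  sum_f_R0 (fun k => G (S k) - G k) n = G (S n) - G 0%nat.
Proof.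
induction n as [|n IH]; simpl; [ring|].
rewrite IH; ring.
Qed.

Lemma central_binom_pos (k : nat) : 0 < Binomial.C (2 * k) k.
Proof.
unfold Binomial.C.
apply Rdiv_lt_0_compat; [|apply Rmult_lt_0_compat]; apply INR_fact_lt_0.
Qed.

Lemma central_binom_S (k : nat) :
  Binomial.C (2 * S k) (S k)
  = Binomial.C (2 * k) k * (2 * (2 * INR k + 1) / (INR k + 1)).
Proof.
unfold Binomial.C.
replace (2 * S k - S k)%nat with (S k) by lia.
replace (2 * k - k)%nat with k by lia.
replace (2 * S k)%nat with (S (S (2 * k))) by lia.
rewrite !fact_simpl, !mult_INR, !S_INR, mult_INR.
pose proof (INR_fact_lt_0 k); pose proof (pos_INR k).
simpl (INR 2); field; lra.
Qed.

(* [cbin k] is the coefficient of [x^(2k)] in [1 / sqrt (1 - x^2)], and [asin2 m]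
   that of [x^(2m)] in [asin x ^ 2]. *)
Definition cbin (k : nat) : R := Binomial.C (2 * k) k / 4 ^ k.
Definition asin2 (m : nat) : R :=
  4 ^ m / (2 * INR m ^ 2 * Binomial.C (2 * m) m).

Lemma cbin_S (k : nat) :
  cbin (S k) = (2 * INR k + 1) / (2 * INR k + 2) * cbin k.
Proof.
unfold cbin; rewrite central_binom_S; simpl (4 ^ S k).
pose proof (pos_INR k); pose proof (pow_lt 4 k); field; lra.
Qed.

Lemma asin2_SS (m : nat) : asin2 (S (S m))
  = 2 * INR (S m) ^ 2 / (INR (S (S m)) * (2 * INR (S m) + 1)) * asin2 (S m).
Proof.
unfold asin2; rewrite (central_binom_S (S m)), (S_INR (S m)).
simpl (4 ^ S (S m)); simpl (4 ^ S m).
pose proof (central_binom_pos (S m)).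
pose proof (pos_INR m); pose proof (pow_lt 4 m).
rewrite !S_INR; field; lra.
Qed.

Lemma asin2_1 : asin2 1 = 1.
Proof. unfold asin2, Binomial.C; simpl; field. Qed.

(** The weight [w] receives both [k] and [m = n - k + 1]. Weight 1 gives the coefficient of
    [x^(2n+2)] in [asin^2 x / sqrt (1 - x^2)]. Weight [m / (2k+1)] gives that of
    [(asin x / x) * (x / 2) * (asin^2 x)'], which is the same function. *)
Definition conv (w : nat -> nat -> R) (n : nat) : R :=
  sum_f_R0 (fun k => w k (n - k + 1)%nat * (cbin k * asin2 (n - k + 1))) n.

(* The first hypothesis says that [r k m * (cbin k * asin2 m)] at [m = n + 2 - k] is a
   creative-telescoping certificate, with [asin2_SS] and [cbin_S] substituted and
   the common factor [cbin k * asin2 (m + 1)] removed. *)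
Lemma conv_recurrence (w r : nat -> nat -> R) (n : nat) :
  (forall k m, (2 * INR k + 2 * INR m + 3) *
     ((2 * INR k + 2 * INR m + 4) * w k (S (S m)) *
        (2 * INR (S m) ^ 2 / (INR (S (S m)) * (2 * INR (S m) + 1)))
      - (2 * INR k + 2 * INR m + 3) * w k (S m))
   = r (S k) (S m) * ((2 * INR k + 1) / (2 * INR k + 2))
     - r k (S (S m)) *
        (2 * INR (S m) ^ 2 / (INR (S (S m)) * (2 * INR (S m) + 1)))) ->
  (forall m, r 0%nat m = 0) ->
  r (S n) 1%nat + (2 * INR n + 3) * (2 * INR n + 4) * w (S n) 1%nat = 2 ->
  (2 * INR n + 3) * (2 * INR n + 4) * conv w (S n)
  = (2 * INR n + 3) ^ 2 * conv w n + 2 * cbin (S n).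
Proof.
intros Hcert r0 Hbdry.
set (G k := r k (S n - k + 1)%nat * (cbin k * asin2 (S n - k + 1))).
set (t N k := w k (N - k + 1)%nat * (cbin k * asin2 (N - k + 1))).
assert (Hs : sum_f_R0 (fun k => (2 * INR n + 3) *
    ((2 * INR n + 4) * t (S n) k - (2 * INR n + 3) * t n k)) n
    = G (S n) - G 0%nat).
{ rewrite <- sum_f_R0_telescope; apply sum_eq; intros k Hk.
  unfold G, t.
  replace (S n - S k + 1)%nat with (S (n - k)) by lia.
  replace (S n - k + 1)%nat with (S (S (n - k))) by lia.
  replace (n - k + 1)%nat with (S (n - k)) by lia.
  rewrite asin2_SS, cbin_S.
  replace (INR n) with (INR (n - k) + INR k)
    by (rewrite <- plus_INR; f_equal; lia).
  generalize (n - k)%nat; intros m.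
  pose proof (Hcert k m) as E.
  transitivity (((2 * INR k + 2 * INR m + 3) *
     ((2 * INR k + 2 * INR m + 4) * w k (S (S m)) *
        (2 * INR (S m) ^ 2 / (INR (S (S m)) * (2 * INR (S m) + 1)))
      - (2 * INR k + 2 * INR m + 3) * w k (S m))) * (cbin k * asin2 (S m)));
    [ring|rewrite E; ring]. }
assert (Hs' : (2 * INR n + 3) * ((2 * INR n + 4) *
   sum_f_R0 (t (S n)) n - (2 * INR n + 3) * conv w n) = G (S n) - G 0%nat).
{ rewrite <- Hs; unfold conv; rewrite !scal_sum, <- minus_sum, scal_sum.
  apply sum_eq; intros; unfold t; ring. }
(* The term [k = n + 1] lies outside the telescoped range. With the upper boundary value [G (S n)]
   it makes [2 * cbin (S n)], by [Hbdry]. *)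
assert (E : conv w (S n) = sum_f_R0 (t (S n)) n + w (S n) 1%nat * cbin (S n)).
{ unfold conv; rewrite tech5.
  replace (S n - S n + 1)%nat with 1%nat by lia.
  rewrite asin2_1; unfold t; ring. }
unfold G in Hs'; rewrite r0 in Hs'.
replace (S n - S n + 1)%nat with 1%nat in Hs' by lia.
rewrite asin2_1 in Hs'; rewrite E.
transitivity ((2 * INR n + 3) * ((2 * INR n + 4) *
   sum_f_R0 (t (S n)) n - (2 * INR n + 3) * conv w n)
   + (2 * INR n + 3) ^ 2 * conv w n +
   (2 * INR n + 3) * (2 * INR n + 4) * w (S n) 1%nat * cbin (S n)).
- ring.
- rewrite Hs'.
  replace (2 * cbin (S n)) with ((r (S n) 1%nat
    + (2 * INR n + 3) * (2 * INR n + 4) * w (S n) 1%nat) * cbin (S n))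
    by (rewrite Hbdry; ring).
  ring.
Qed.

Lemma conv_const_recurrence (n : nat) :
  (2 * INR n + 3) * (2 * INR n + 4) * conv (fun _ _ => 1) (S n)
  = (2 * INR n + 3) ^ 2 * conv (fun _ _ => 1) n + 2 * cbin (S n).
Proof.
(* The certificate vanishes at [k = 0]; at [k = n + 1], [m = 1] it is [- 2 (n+1) (2n+5)], which
   falls short of [- (2n+3) (2n+4)] by exactly 2 in absolute value. *)
apply (conv_recurrence _
  (fun k m => 2 * INR k * (1 - 4 * INR m - 2 * INR k))).
- intros k m; pose proof (pos_INR m); pose proof (pos_INR k).
  rewrite !S_INR; field; lra.
- intros m; simpl; ring.
- rewrite S_INR; simpl; ring.
Qed.

Lemma conv_ratio_recurrence (n : nat) :
  let w := fun k m => INR m / (2 * INR k + 1) in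
  (2 * INR n + 3) * (2 * INR n + 4) * conv w (S n)
  = (2 * INR n + 3) ^ 2 * conv w n + 2 * cbin (S n).
Proof.
apply (conv_recurrence _ (fun k m => - (2 * INR k * INR m))).
- intros k m; pose proof (pos_INR m); pose proof (pos_INR k).
  rewrite !S_INR; field; lra.
- intros m; simpl; ring.
- pose proof (pos_INR n); rewrite S_INR; simpl (INR 1); field; lra.
Qed.

Lemma recurrence_unique (u v f g h : nat -> R) :
  u 0%nat = v 0%nat ->
  (forall n, f n <> 0) ->
  (forall n, f n * u (S n) = g n * u n + h n) ->
  (forall n, f n * v (S n) = g n * v n + h n) ->
  forall n, u n = v n.
Proof.
intros H0 Hf Hu Hv n; induction n as [|n IH]; [exact H0|].
apply (Rmult_eq_reg_l (f n)); [rewrite Hu, Hv, IH; reflexivity|apply Hf].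
Qed.

Definition odd_inv_sq (n : nat) : R :=
  sum_f_R0 (fun k => / (2 * INR k + 1) ^ 2) n.

Lemma double_fact_odd (n : nat) :
  INR (double_fact (2 * n + 1)) = INR (fact (2 * n + 1)) / (2 ^ n * INR (fact n)).
Proof.
induction n as [|n IH]; [simpl; field|].
replace (2 * S n + 1)%nat with (S (S (2 * n + 1))) by lia.
change (double_fact (S (S (2 * n + 1))))
  with ((S (S (2 * n + 1))) * double_fact (2 * n + 1))%nat.
rewrite mult_INR, IH, !fact_simpl, !mult_INR.
pose proof (INR_fact_lt_0 n); pose proof (pow_lt 2 n).
pose proof (pos_INR n).
rewrite !S_INR, plus_INR, mult_INR; simpl (2 ^ S n); simpl (INR 2); simpl (INR 1).
field; lra.
Qed.

(** Both sides are [cbin (S n)], so the prefactor of the closed form inherits the rational step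
    ratio of [cbin]. *)
Lemma cbin_double_fact (n : nat) :
  INR (double_fact (2 * n + 1)) ^ 2 / INR (fact (2 * n + 2))
  = (2 * INR n + 1) / (2 * INR n + 2) * cbin n.
Proof.
rewrite double_fact_odd; unfold cbin, Binomial.C.
replace (2 * n - n)%nat with n by lia.
replace (2 * n + 2)%nat with (S (2 * n + 1)) by lia.
replace (2 * n + 1)%nat with (S (2 * n)) by lia.
rewrite !fact_simpl, !mult_INR, !S_INR, mult_INR.
pose proof (INR_fact_lt_0 n); pose proof (pow_lt 2 n).
pose proof (pos_INR n); pose proof (INR_fact_lt_0 (2 * n)).
replace (4 ^ n) with (2 ^ n * 2 ^ n) by (rewrite <- Rpow_mult_distr; f_equal; lra).
simpl (INR 2); field; lra.
Qed.

(** Substituting [c n = 2 * cbin (S n) * s n] turns the recurrence into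
    [s (n+1) - s n = 1 / (2n+3)^2], and [c 0 = 1] means [s 0 = 1]. *)
Lemma conv_closed_form (c : nat -> R) :
  c 0%nat = 1 ->
  (forall n, (2 * INR n + 3) * (2 * INR n + 4) * c (S n)
    = (2 * INR n + 3) ^ 2 * c n + 2 * cbin (S n)) ->
  forall n, c n = 2 * (INR (double_fact (2 * n + 1)) ^ 2
                       / INR (fact (2 * n + 2)) * odd_inv_sq n).
Proof.
intros c0 cS; apply (recurrence_unique c _
  (fun n => (2 * INR n + 3) * (2 * INR n + 4))
  (fun n => (2 * INR n + 3) ^ 2) (fun n => 2 * cbin (S n))); trivial.
- rewrite c0; unfold odd_inv_sq; simpl; field.
- intros n; pose proof (pos_INR n); nra.
- intros n; rewrite !cbin_double_fact; unfold odd_inv_sq; rewrite tech5.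
  rewrite cbin_S; pose proof (pos_INR n); rewrite S_INR; field; lra.
Qed.

(** Termwise, this is [2m = (2n+3) - (2k+1)] divided by [2k+1]. *)
Lemma conv_ratio_const (n : nat) :
  2 * conv (fun k m => INR m / (2 * INR k + 1)) n
  = (2 * INR n + 3) * conv (fun k _ => / (2 * INR k + 1)) n
    - conv (fun _ _ => 1) n.
Proof.
unfold conv; rewrite !scal_sum, <- minus_sum; apply sum_eq; intros k Hk.
replace (INR n) with (INR (n - k) + INR k)
  by (rewrite <- plus_INR; f_equal; lia).
pose proof (pos_INR k); rewrite plus_INR; simpl (INR 1); field; lra.
Qed.

Lemma conv_const_closed_form (n : nat) :
  conv (fun _ _ => 1) n
  = 2 * (INR (double_fact (2 * n + 1)) ^ 2 / INR (fact (2 * n + 2)) * odd_inv_sq n).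
Proof.
apply conv_closed_form; [|exact conv_const_recurrence].
unfold conv; simpl; rewrite asin2_1; unfold cbin, Binomial.C; simpl; field.
Qed.

Lemma conv_ratio_closed_form (n : nat) :
  conv (fun k m => INR m / (2 * INR k + 1)) n
  = 2 * (INR (double_fact (2 * n + 1)) ^ 2 / INR (fact (2 * n + 2)) * odd_inv_sq n).
Proof.
apply conv_closed_form; [|exact conv_ratio_recurrence].
unfold conv; simpl; rewrite asin2_1; unfold cbin, Binomial.C; simpl; field.
Qed.

(** The other two weights share one closed form, so [2n+3] times this sum is three times that form;
    the factor [2n+3] is absorbed in [(2n+3)!]. *)
Lemma conv_inv_closed_form (n : nat) :
  conv (fun k _ => / (2 * INR k + 1)) n
  = 6 * (INR (double_fact (2 * n + 1)) ^ 2 / INR (fact (2 * n + 3)) * odd_inv_sq n).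
Proof.
pose proof (conv_ratio_const n) as E; pose proof (pos_INR n).
rewrite conv_ratio_closed_form, conv_const_closed_form in E.
apply (Rmult_eq_reg_l (2 * INR n + 3)); [|lra].
replace (2 * n + 3)%nat with (S (2 * n + 2)) by lia.
rewrite fact_simpl, mult_INR, S_INR, plus_INR, mult_INR; simpl (INR 2).
pose proof (INR_fact_lt_0 (2 * n + 2)).
transitivity (3 * (2 * (INR (double_fact (2 * n + 1)) ^ 2 / INR (fact (2 * n + 2)) * odd_inv_sq n))); [lra|].
field; lra.
Qed.

(** Since [k + m = n + 1], the powers of 4 in [cbin k * asin2 m] combine to [4^(n+1) / 2^(4k)],
    leaving a constant factor outside the sum. The index [m] is always positive, so the division by
    [m^2] is genuine. *)
Lemma sum_conv (w w' : nat -> nat -> R) (n : nat) :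
  (forall k m, (0 < m)%nat -> w' k m = w k m / (2 ^ (4 * k) * INR m ^ 2)) ->
  sum_f_R0 (fun k => w' k (n - k + 1)%nat
    * (Binomial.C (2 * k) k / Binomial.C (2 * (n - k + 1)) (n - k + 1))) n
  = 2 / 4 ^ (n + 1) * conv w n.
Proof.
intros Hw; unfold conv; rewrite scal_sum; apply sum_eq; intros k Hk.
rewrite Hw by lia.
unfold cbin, asin2.
replace (4 ^ (n + 1)) with (4 ^ k * 4 ^ (n - k + 1))
  by (rewrite <- pow_add; f_equal; lia).
assert (0 < INR (n - k + 1)) by (apply lt_0_INR; lia).
revert H; generalize (n - k + 1)%nat; intros m Hm.
replace (2 ^ (4 * k)) with (4 ^ k * 4 ^ k).
2: { rewrite <- Rpow_mult_distr, pow_mult; f_equal; simpl; ring. }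
pose proof (pow_lt 4 k); pose proof (pow_lt 4 m); pose proof (central_binom_pos m).
field; lra.
Qed.

(** * The sum of inverse odd squares *)

Lemma inv_sin_sq_duplication (x : R) :
  0 < x < PI / 2 ->
  / sin x ^ 2 + / sin (PI / 2 - x) ^ 2 = 4 / sin (2 * x) ^ 2.
Proof.
intros Hx; rewrite sin_shift, sin_2a.
assert (0 < sin x) by (apply sin_gt_0; lra).
assert (0 < cos x) by (apply cos_gt_0; lra).
transitivity ((sin x ^ 2 + cos x ^ 2) / (sin x ^ 2 * cos x ^ 2)); [field; lra|].
replace (sin x ^ 2 + cos x ^ 2) with 1
  by (rewrite <- (sin2_cos2 x); unfold Rsqr; ring).
field; lra.
Qed.

(** Pairing [k] with [2N + 1 - k] will pair each angle with its complement. *)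
Lemma sum_f_R0_reflect (f : nat -> R) (N : nat) :
  sum_f_R0 f (2 * N + 1)
  = sum_f_R0 (fun k => f k + f (2 * N + 1 - k)%nat) N.
Proof.
revert f; induction N as [|N IH]; intros f; [reflexivity|].
replace (2 * S N + 1)%nat with (S (S (2 * N + 1))) by lia.
rewrite tech5, (decomp_sum f), (decomp_sum _ (S N)) by lia; simpl pred.
rewrite IH, (sum_eq (fun k => f (S k) + f (S (2 * N + 1 - k)))
  (fun k => f (S k) + f (S (S (2 * N + 1)) - S k)%nat)).
- rewrite Nat.sub_0_r; ring.
- intros k Hk; do 2 f_equal; lia.
Qed.

(** These are the midpoints of the [2^n] equal parts of the interval from 0 to [PI / 2]. *)
Definition odd_angle (n k : nat) : R := (2 * INR k + 1) * PI / (4 * 2 ^ n).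

Lemma odd_angle_bounds (n k : nat) :
  (k <= 2 ^ n - 1)%nat -> 0 < odd_angle n k < PI / 2.
Proof.
intros Hk; unfold odd_angle.
pose proof (pow_lt 2 n); pose proof PI_RGT_0; pose proof (pos_INR k).
assert (Hk' : INR k + 1 <= 2 ^ n).
{ replace 2 with (INR 2) by reflexivity; rewrite <- pow_INR, <- S_INR.
  apply le_INR; pose proof (Nat.pow_nonzero 2 n); lia. }
split.
- apply Rdiv_lt_0_compat; nra.
- apply (Rmult_lt_reg_r (4 * 2 ^ n)); [lra|].
  field_simplify; [nra|lra].
Qed.

(** At level [n + 1], reflected indices give complementary angles. By duplication each pair
    contributes [4 / sin^2] of the doubled angle, which is an angle of level [n]; hence the sum
    quadruples. *)
Lemma sum_inv_sin_sq (n : nat) :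
  sum_f_R0 (fun k => / sin (odd_angle n k) ^ 2) (2 ^ n - 1) = 2 * 4 ^ n.
Proof.
induction n as [|n IH].
- unfold odd_angle; simpl.
  replace ((2 * 0 + 1) * PI / (4 * 1)) with (PI / 4) by field.
  rewrite sin_PI4.
  assert (Hs : sqrt 2 * sqrt 2 = 2) by (apply sqrt_sqrt; lra).
  assert (sqrt 2 <> 0) by nra.
  replace (1 / sqrt 2 * (1 / sqrt 2 * 1)) with (/ (sqrt 2 * sqrt 2)) by (field; auto).
  rewrite Hs; field.
- pose proof (Nat.pow_nonzero 2 n).
  replace (2 ^ S n - 1)%nat with (2 * (2 ^ n - 1) + 1)%nat
    by (rewrite Nat.pow_succ_r'; lia).
  rewrite sum_f_R0_reflect; simpl (4 ^ S n).
  replace (2 * (4 * 4 ^ n)) with (4 * (2 * 4 ^ n)) by ring.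
  rewrite <- IH, scal_sum; apply sum_eq; intros k Hk.
  pose proof (pow_lt 2 n).
  assert (Hn : odd_angle n k = 2 * odd_angle (S n) k)
    by (unfold odd_angle; simpl; field; lra).
  replace (odd_angle (S n) (2 * (2 ^ n - 1) + 1 - k)) with (PI / 2 - odd_angle (S n) k).
  2: { unfold odd_angle.
       rewrite !minus_INR, plus_INR, mult_INR, minus_INR by lia.
       rewrite pow_INR; simpl (INR 2); simpl (INR 1); simpl (2 ^ S n).
       replace (1 + 1) with 2 by ring; field; lra. }
  rewrite inv_sin_sq_duplication.
  + rewrite Hn; field.
    assert (0 < sin (2 * odd_angle (S n) k)); [|lra].
    rewrite <- Hn; pose proof (odd_angle_bounds n k Hk).
    apply sin_gt_0; lra.
  + apply odd_angle_bounds; rewrite Nat.pow_succ_r'; lia.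
Qed.

(** This is [sin x < x <= tan x], inverted and squared, with [1 / tan^2 x = 1 / sin^2 x - 1]. *)
Lemma inv_sq_bounds (x : R) :
  0 < x < PI / 2 -> / sin x ^ 2 - 1 <= / x ^ 2 <= / sin x ^ 2.
Proof.
intros Hx.
assert (Hs : 0 < sin x) by (apply sin_gt_0; lra).
assert (Hc : 0 < cos x) by (apply cos_gt_0; lra).
assert (sin x < x) by (apply sin_lt_x; lra).
(* The difference [sin y - y cos y] vanishes at 0 and has derivative [y sin y], positive here. *)
assert (Ht : x * cos x <= sin x).
{ destruct (MVT_cor2 (fun y => sin y - y * cos y) (fun y => y * sin y) 0 x) as [c [Hd Hc']].
  - lra.
  - intros c Hc'; apply is_derive_Reals; auto_derive; [trivial|ring].
  - assert (0 < sin c) by (apply sin_gt_0; lra).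
    assert (0 < c * sin c * (x - 0)) by (repeat apply Rmult_lt_0_compat; lra).
    rewrite sin_0 in Hd; lra. }
split.
- replace (/ sin x ^ 2 - 1) with (/ (sin x / cos x) ^ 2).
  + apply Rinv_le_contravar; [apply pow_lt; lra|].
    apply pow_incr; split; [lra|].
    apply (Rmult_le_reg_r (cos x)); [lra|]; field_simplify; lra.
  + rewrite <- (Rmult_1_l 1) at 1.
    replace (/ (sin x / cos x) ^ 2) with (cos x ^ 2 / sin x ^ 2) by (field; lra).
    replace (cos x ^ 2) with (1 - sin x ^ 2)
      by (rewrite <- (sin2_cos2 x); unfold Rsqr; ring).
    field; lra.
- apply Rinv_le_contravar; [apply pow_lt; lra|apply pow_incr; lra].
Qed.

(** Rescaling turns the terms into [1 / odd_angle^2]. The loss of at most 1 in each of the [2^n]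
    terms, times [PI^2 / (16 * 4^n)], is the error on the left. *)
Lemma odd_inv_sq_pow2_bounds (n : nat) :
  PI ^ 2 / 8 - PI ^ 2 / 16 * (/ 2) ^ n <= odd_inv_sq (2 ^ n - 1) <= PI ^ 2 / 8.
Proof.
pose proof PI_RGT_0; pose proof (pow_lt 2 n).
pose proof (Nat.pow_nonzero 2 n).
assert (Hq : odd_inv_sq (2 ^ n - 1) = PI ^ 2 / (16 * 4 ^ n)
  * sum_f_R0 (fun k => / odd_angle n k ^ 2) (2 ^ n - 1)).
{ unfold odd_inv_sq; rewrite scal_sum; apply sum_eq; intros k _.
  unfold odd_angle; pose proof (pos_INR k).
  replace (4 ^ n) with (2 ^ n * 2 ^ n) by (rewrite <- Rpow_mult_distr; f_equal; lra).
  field; repeat split; lra. }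
assert (H4 : 4 ^ n = 2 ^ n * 2 ^ n) by (rewrite <- Rpow_mult_distr; f_equal; lra).
assert (Hup : sum_f_R0 (fun k => / odd_angle n k ^ 2) (2 ^ n - 1) <= 2 * 4 ^ n).
{ rewrite <- sum_inv_sin_sq; apply sum_Rle; intros k Hk.
  apply inv_sq_bounds, odd_angle_bounds, Hk. }
assert (Hlo : 2 * 4 ^ n - 2 ^ n
  <= sum_f_R0 (fun k => / odd_angle n k ^ 2) (2 ^ n - 1)).
{ rewrite <- sum_inv_sin_sq.
  replace (2 ^ n) with (sum_f_R0 (fun _ => 1) (2 ^ n - 1)).
  - rewrite <- minus_sum; apply sum_Rle; intros k Hk.
    apply inv_sq_bounds, odd_angle_bounds, Hk.
  - rewrite sum_cte, Rmult_1_l.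
    replace (S (2 ^ n - 1)) with (2 ^ n)%nat by lia.
    rewrite pow_INR; reflexivity. }
rewrite Hq, pow_inv.
split.
- replace (PI ^ 2 / 8 - PI ^ 2 / 16 * / 2 ^ n)
    with (PI ^ 2 / (16 * 4 ^ n) * (2 * 4 ^ n - 2 ^ n)) by (rewrite H4; field; lra).
  apply Rmult_le_compat_l; [|exact Hlo].
  apply Rlt_le, Rdiv_lt_0_compat; nra.
- replace (PI ^ 2 / 8) with (PI ^ 2 / (16 * 4 ^ n) * (2 * 4 ^ n))
    by (rewrite H4; field; lra).
  apply Rmult_le_compat_l; [|exact Hup].
  apply Rlt_le, Rdiv_lt_0_compat; nra.
Qed.

(** With convergence assumed, the limit can be read off along the indices [2^n - 1]; convergence
    itself will come from the trigamma series. *)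
Lemma odd_inv_sq_lim (l : R) : is_lim_seq odd_inv_sq l -> l = PI ^ 2 / 8.
Proof.
intros Hl.
assert (Hp : filterlim (fun n => (2 ^ n - 1)%nat) eventually eventually).
{ apply eventually_subseq_loc; exists 0%nat; intros n _.
  pose proof (Nat.pow_nonzero 2 n); rewrite Nat.pow_succ_r'; lia. }
apply (is_lim_seq_subseq _ _ _ Hp), is_lim_seq_unique in Hl.
assert (Hg : is_lim_seq (fun n => PI ^ 2 / 8 - PI ^ 2 / 16 * (/ 2) ^ n) (PI ^ 2 / 8)).
{ replace (Finite (PI ^ 2 / 8)) with (Finite (PI ^ 2 / 8 - PI ^ 2 / 16 * 0))
    by (f_equal; ring).
  apply is_lim_seq_minus'; [apply is_lim_seq_const|].
  apply (is_lim_seq_scal_l _ _ 0), is_lim_seq_geom; rewrite Rabs_right; lra. }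
assert (Hs : is_lim_seq (fun n => odd_inv_sq (2 ^ n - 1)) (PI ^ 2 / 8)).
{ apply (is_lim_seq_le_le (fun n => PI ^ 2 / 8 - PI ^ 2 / 16 * (/ 2) ^ n) _
    (fun _ => PI ^ 2 / 8)); [intros n; apply odd_inv_sq_pow2_bounds|exact Hg|
    apply is_lim_seq_const]. }
apply is_lim_seq_unique in Hs; congruence.
Qed.

(** * The Gamma function *)

(** Integrals of a nonnegative function grow with the interval, so the improper integral is their
    supremum. The second conclusion later bounds the Gamma integral below by a positive proper
    one. *)
Lemma is_RInt_gen_bounded_nonneg (f : R -> R) (M : R) :
  (forall t, 0 < t -> continuous f t) ->
  (forall t, 0 < t -> 0 <= f t) ->
  (forall a b, 0 < a <= b -> RInt f a b <= M) ->
  exists l, is_RInt_gen f (at_right 0) (Rbar_locally p_infty) l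
    /\ forall a b, 0 < a <= b -> RInt f a b <= l.
Proof.
intros Hc Hp HM.
assert (Hex : forall a b, 0 < a <= b -> ex_RInt f a b).
{ intros a b Hab; apply (ex_RInt_continuous (V := R_CompleteNormedModule)); intros z Hz.
  rewrite Rmin_left in Hz by lra; apply Hc; lra. }
assert (Hpos : forall a b, 0 < a <= b -> 0 <= RInt f a b).
{ intros a b Hab; apply RInt_ge_0; [lra|apply Hex; lra|].
  intros t Ht; apply Hp; lra. }
destruct (completeness (fun v => exists a b, 0 < a <= b /\ v = RInt f a b))
  as [l [Hub Hlub]].
{ exists M; intros v (a & b & Hab & ->); apply HM, Hab. }
{ exists (RInt f 1 1), 1, 1; split; [lra|reflexivity]. }
assert (Hle : forall a b, 0 < a <= b -> RInt f a b <= l).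
{ intros a b Hab; apply Hub; exists a, b; split; [exact Hab|reflexivity]. }
exists l; split; [|exact Hle].
intros P [eps HP].
assert (Hnear : exists a b, 0 < a <= b /\ l - eps < RInt f a b).
{ destruct (Classical_Prop.classic (exists a b, 0 < a <= b /\ l - eps < RInt f a b))
    as [H|H]; [exact H|exfalso].
  assert (l <= l - eps); [|destruct eps; simpl in *; lra].
  apply Hlub; intros v (a & b & Hab & ->).
  apply Rnot_lt_le; intros Hlt; apply H; exists a, b; split; assumption. }
destruct Hnear as (a0 & b0 & Hab0 & Heps).
(* Every interval containing [[a0, b0]] has its integral between [l - eps] and [l]. *)
apply (Filter_prod _ _ _ (fun a => 0 < a <= a0) (fun b => b0 < b)).
- assert (Ha0 : 0 < a0) by lra.
  exists (mkposreal a0 Ha0); intros a Ha Hpa.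
  apply Rabs_lt_between' in Ha; simpl in Ha; lra.
- exists b0; intros b Hb; exact Hb.
- intros a b Ha Hb; exists (RInt f a b); simpl; split.
  + apply (RInt_correct (V := R_CompleteNormedModule)), Hex; lra.
  + apply HP.
    assert (H1 : RInt f a b = RInt f a a0 + RInt f a0 b0 + RInt f b0 b).
    { pose proof (RInt_Chasles (V := R_CompleteNormedModule) f a a0 b0 (Hex a a0 ltac:(lra)) (Hex a0 b0 ltac:(lra))) as E1.
      pose proof (RInt_Chasles (V := R_CompleteNormedModule) f a b0 b (Hex a b0 ltac:(lra)) (Hex b0 b ltac:(lra))) as E2.
      change plus with Rplus in E1, E2; lra. }
    pose proof (Hpos a a0 ltac:(lra)); pose proof (Hpos b0 b ltac:(lra)).
    pose proof (Hle a b ltac:(lra)).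
    apply Rabs_def1; unfold minus, plus, opp; simpl; destruct eps; simpl in *; lra.
Qed.

(** Both endpoints are eventually positive, so facts about the integrand on [t > 0] suffice. *)
Lemma filter_prod_pos (Q : R -> Prop) :
  (forall t, 0 < t -> Q t) ->
  filter_prod (at_right 0) (Rbar_locally p_infty) (fun ab =>
    forall t, Rmin (fst ab) (snd ab) <= t <= Rmax (fst ab) (snd ab) -> Q t).
Proof.
intros HQ; apply (Filter_prod _ _ _ (fun a => 0 < a) (fun b => 0 < b)).
- exists (mkposreal 1 Rlt_0_1); intros; assumption.
- exists 0; intros; assumption.
- intros a b Ha Hb t Ht; apply HQ; simpl in Ht.
  pose proof (Rmin_glb_lt a b 0 Ha Hb); lra.
Qed.

Lemma filter_prod_le :
  filter_prod (at_right 0) (Rbar_locally p_infty) (fun ab => fst ab <= snd ab).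
Proof.
apply (Filter_prod _ _ _ (fun a => a < 1) (fun b => 1 < b)).
- exists (mkposreal 1 Rlt_0_1); intros y Hy _.
  apply Rabs_lt_between' in Hy; simpl in Hy; lra.
- exists 1; intros; assumption.
- intros a b Ha Hb; simpl; lra.
Qed.

Lemma is_RInt_gen_pos_ext (f g : R -> R) (l : R) :
  (forall t, 0 < t -> f t = g t) ->
  is_RInt_gen f (at_right 0) (Rbar_locally p_infty) l ->
  is_RInt_gen g (at_right 0) (Rbar_locally p_infty) l.
Proof.
intros Hfg; apply is_RInt_gen_ext.
eapply filter_imp; [|apply (filter_prod_pos (fun t => f t = g t)), Hfg].
intros ab H t Ht; apply H; lra.
Qed.

Lemma is_RInt_gen_le (f g : R -> R) (lf lg : R) :
  (forall t, 0 < t -> 0 <= f t <= g t) ->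
  is_RInt_gen f (at_right 0) (Rbar_locally p_infty) lf ->
  is_RInt_gen g (at_right 0) (Rbar_locally p_infty) lg ->
  lf <= lg.
Proof.
intros Hfg Hf Hg; apply Rle_trans with (norm lf); [apply Rle_abs|].
apply (RInt_gen_norm (V := R_CompleteNormedModule) (Fa := at_right 0)
  (Fb := Rbar_locally p_infty) f g lf lg); trivial.
- apply filter_prod_le.
- eapply filter_imp; [|apply (filter_prod_pos (fun t => norm (f t) <= g t))].
  { intros [a b] H t Ht; apply H; simpl in *.
    pose proof (Rmin_l a b); pose proof (Rmax_r a b); lra. }
  intros t Ht.
  destruct (Hfg t Ht); unfold norm; simpl; unfold abs; simpl.
  rewrite Rabs_pos_eq; assumption.
Qed.

(* Weighted AM-GM; the two tangent-line bounds at [s ln t] cancel to first order. *)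
Lemma Rpower_le_affine (t s : R) :
  0 < t -> 0 <= s <= 1 -> Rpower t s <= s * t + (1 - s).
Proof.
intros Ht Hs; unfold Rpower; set (u := ln t).
replace t with (exp (s * u) * exp ((1 - s) * u)).
2: { rewrite <- exp_plus; replace (s * u + (1 - s) * u) with u by ring.
     apply exp_ln, Ht. }
assert (H1 : 1 = exp (s * u) * exp (- (s * u)))
  by (rewrite <- exp_plus, Rplus_opp_r, exp_0; reflexivity).
pose proof (exp_pos (s * u)).
pose proof (Rmult_le_compat_l (exp (s * u) * s) _ _ ltac:(nra)
  (exp_ineq1_le ((1 - s) * u))).
pose proof (Rmult_le_compat_l (exp (s * u) * (1 - s)) _ _ ltac:(nra)
  (exp_ineq1_le (- (s * u)))).
nra.
Qed.

(** * Convergence and functional equation of Euler's integral *)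

Definition Gamma_integrand (x t : R) : R := Rpower t (x - 1) * exp (- t).
Definition Gamma_boundary (x t : R) : R := Rpower t x * exp (- t).

Lemma Gamma_integrand_pos (x t : R) : 0 < Gamma_integrand x t.
Proof. apply Rmult_lt_0_compat; apply exp_pos. Qed.

Lemma Gamma_boundary_derive (x t : R) : 0 < t ->
  is_derive (Gamma_boundary x) t
    (x * Gamma_integrand x t - Gamma_integrand (x + 1) t).
Proof.
intros Ht; unfold Gamma_boundary, Gamma_integrand.
replace (x + 1 - 1) with x by ring.
apply is_derive_Reals.
replace (x * (Rpower t (x - 1) * exp (- t)) - Rpower t x * exp (- t))
  with (x * Rpower t (x - 1) * exp (- t) + Rpower t x * - exp (- t)) by ring.
apply (derivable_pt_lim_mult (fun t => Rpower t x) (fun t => exp (- t))).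
- apply derivable_pt_lim_power, Ht.
- apply is_derive_Reals; auto_derive; [trivial|ring].
Qed.

Lemma Gamma_integrand_continuous (x t : R) :
  0 < t -> continuous (Gamma_integrand x) t.
Proof.
intros Ht; apply (ex_derive_continuous (V := R_NormedModule)).
(* [Gamma_integrand x] is [Gamma_boundary (x - 1)] by unfolding. *)
eexists; apply (is_derive_ext (Gamma_boundary (x - 1))).
- intros u; reflexivity.
- apply Gamma_boundary_derive, Ht.
Qed.

Lemma Gamma_boundary_lim_0 (x : R) :
  0 < x -> filterlim (Gamma_boundary x) (at_right 0) (locally 0).
Proof.
intros Hx; unfold Gamma_boundary.
replace 0 with (0 * exp (- 0)) at 2 by ring.
apply (filterlim_comp_2 (G := locally 0) (H := locally (exp (- 0)))).
- apply (filterlim_comp _ _ _ (fun t => x * ln t) exp _ (Rbar_locally m_infty)).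
  + apply (filterlim_comp _ _ _ ln (fun u => x * u) _ (Rbar_locally m_infty));
      [exact is_lim_ln_0|].
    evar_last; [apply (filterlim_Rbar_mult_l x m_infty)|].
    simpl; destruct (Rle_dec 0 x) as [H|H]; [|lra].
    destruct (Rle_lt_or_eq_dec 0 x H); [reflexivity|lra].
  + exact is_lim_exp_m.
- eapply filterlim_filter_le_1; [apply (filter_le_within (F := locally 0))|].
  apply (ex_derive_continuous (fun t => exp (- t)) 0); auto_derive; trivial.
- apply (filterlim_mult 0 (exp (- 0))).
Qed.

Lemma Gamma_boundary_lim_p_infty (x : R) :
  0 < x -> filterlim (Gamma_boundary x) (Rbar_locally p_infty) (locally 0).
Proof.
intros Hx.
set (C := exp (x * ln (2 * x))).
(* [ln u <= u] at [u = t / (2 x)] gives [x ln t - t <= x ln (2 x) - t / 2] *)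
assert (Hb : forall t, 0 < t -> 0 <= Gamma_boundary x t <= C * exp (- (t / 2))).
{ intros t Ht; split; [apply Rlt_le, Rmult_lt_0_compat; apply exp_pos|].
  unfold Gamma_boundary, Rpower, C; rewrite <- !exp_plus.
  assert (Hu : 0 < t / (2 * x)) by (apply Rdiv_lt_0_compat; lra).
  assert (Hl : ln (t / (2 * x)) <= t / (2 * x)).
  { pose proof (exp_ineq1_le (ln (t / (2 * x)))) as E.
    rewrite exp_ln in E by exact Hu; lra. }
  rewrite ln_div in Hl by lra.
  apply (Rmult_le_compat_l x) in Hl; [|lra].
  replace (x * (t / (2 * x))) with (t / 2) in Hl by (field; lra).
  assert (E : x * ln t + - t <= x * ln (2 * x) + - (t / 2)) by lra.
  destruct (Rle_lt_or_eq_dec _ _ E) as [H|H];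
    [apply Rlt_le, exp_increasing, H|rewrite H; apply Rle_refl]. }
apply (is_lim_le_le_loc (fun _ => 0) (fun t => C * exp (- (t / 2))) (Gamma_boundary x) p_infty 0).
- exists 0; intros t Ht; apply Hb, Ht.
- apply is_lim_const.
- replace (Finite 0) with (Rbar_mult C 0) by (simpl; f_equal; ring).
  apply is_lim_scal_l.
  apply (is_lim_comp exp (fun t => - (t / 2)) p_infty 0 m_infty is_lim_exp_m).
  + replace m_infty with (Rbar_mult (- / 2) p_infty).
    * apply (is_lim_ext (fun t => - / 2 * t)); [intros; field|].
      apply is_lim_scal_l, is_lim_id.
    * simpl; destruct (Rle_dec 0 (- / 2)); [exfalso; lra|reflexivity].
  + exists 0; intros; discriminate.
Qed.

(** Integration by parts: [x] times the integrand at [x], minus the integrand at [x + 1], is the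
    derivative of [Gamma_boundary x], which tends to 0 at both ends. *)
Lemma is_RInt_gen_Gamma_step (x l : R) :
  0 < x ->
  is_RInt_gen (Gamma_integrand x) (at_right 0) (Rbar_locally p_infty) l ->
  is_RInt_gen (Gamma_integrand (x + 1)) (at_right 0) (Rbar_locally p_infty) (x * l).
Proof.
intros Hx Hl.
assert (HD : forall t, 0 < t -> Derive (Gamma_boundary x) t
  = x * Gamma_integrand x t - Gamma_integrand (x + 1) t)
  by (intros t Ht; apply is_derive_unique, Gamma_boundary_derive, Ht).
assert (Hb : is_RInt_gen (Derive (Gamma_boundary x)) (at_right 0)
  (Rbar_locally p_infty) (0 - 0)).
{ apply is_RInt_gen_Derive.
  - apply filter_prod_pos; intros t Ht; eexists; apply Gamma_boundary_derive, Ht.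
  - apply filter_prod_pos; intros t Ht.
    apply (continuous_ext_loc _ (fun t => minus (scal x (Gamma_integrand x t))
      (Gamma_integrand (x + 1) t))).
    (* The ball of radius [t] about [t] stays in the half-line where [HD] applies. *)
    + exists (mkposreal t Ht); intros u Hu; apply Rabs_lt_between' in Hu; simpl in Hu.
      rewrite HD by lra; reflexivity.
    + apply (continuous_minus (V := R_NormedModule)).
      * apply (continuous_scal_r (V := R_NormedModule)), Gamma_integrand_continuous, Ht.
      * apply Gamma_integrand_continuous, Ht.
  - apply Gamma_boundary_lim_0, Hx.
  - apply Gamma_boundary_lim_p_infty, Hx. }
replace (x * l) with (minus (scal x l) (0 - 0))
  by (unfold minus, plus, opp, scal; simpl; unfold mult; simpl; ring).
apply (is_RInt_gen_pos_ext (fun t => minus (scal x (Gamma_integrand x t))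
  (Derive (Gamma_boundary x) t))).
- intros t Ht; rewrite HD by exact Ht.
  unfold minus, plus, opp, scal; simpl; unfold mult; simpl; ring.
- apply (is_RInt_gen_minus (V := R_NormedModule)); [|exact Hb].
  apply (is_RInt_gen_scal (V := R_NormedModule)), Hl.
Qed.

(* [P t = (t^x - 2 - t) e^(-t) / x] is nonpositive and its derivative dominates the
   integrand, both because [t^x <= 1 + t]. *)
Lemma ex_Gamma_small (x : R) : 0 < x <= 1 ->
  exists l, 0 < l /\
    is_RInt_gen (Gamma_integrand x) (at_right 0) (Rbar_locally p_infty) l.
Proof.
intros Hx.
set (P := fun t => / x * (Gamma_boundary x t - (2 + t) * exp (- t))).
set (dP := fun t => Gamma_integrand x t
  + / x * (1 + t - Rpower t x) * exp (- t)).
assert (HP : forall t, 0 < t -> is_derive P t (dP t)).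
{ intros t Ht; unfold P, dP.
  evar_last.
  - apply is_derive_scal, (is_derive_minus (V := R_NormedModule));
      [apply Gamma_boundary_derive, Ht|].
    auto_derive; [trivial|reflexivity].
  - unfold minus, plus, opp; simpl; unfold Gamma_integrand.
    replace (x + 1 - 1) with x by ring; field; lra. }
assert (Hpow : forall t, 0 < t -> Rpower t x <= 1 + t).
{ intros t Ht; pose proof (Rpower_le_affine t x Ht ltac:(lra)); nra. }
assert (Hinv : 0 < / x) by (apply Rinv_0_lt_compat; lra).
assert (HdP : forall t, 0 < t -> continuous dP t).
{ unfold dP, Rpower; intros t Ht; apply (continuous_plus (V := R_NormedModule));
    [apply Gamma_integrand_continuous, Ht|].
  apply (ex_derive_continuous (V := R_NormedModule)).
  auto_derive; lra. }
destruct (is_RInt_gen_bounded_nonneg (Gamma_integrand x) (2 * / x)) as (l & Hl & Hle).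
- intros t; apply Gamma_integrand_continuous.
- intros t _; apply Rlt_le, Gamma_integrand_pos.
- intros a b Hab.
  apply Rle_trans with (P b - P a).
  + apply (is_RInt_le (Gamma_integrand x) dP a b); [lra| | |].
    * apply (RInt_correct (V := R_CompleteNormedModule)), (ex_RInt_continuous (V := R_CompleteNormedModule)).
      intros z Hz; rewrite Rmin_left in Hz by lra.
      apply Gamma_integrand_continuous; lra.
    * apply (is_RInt_derive (V := R_CompleteNormedModule) P dP);
        intros z Hz; rewrite Rmin_left in Hz by lra; [apply HP|apply HdP]; lra.
    * intros t Ht; unfold dP; pose proof (Hpow t ltac:(lra)).
      assert (0 <= / x * (1 + t - Rpower t x) * exp (- t)); [|lra].
      pose proof (exp_pos (- t)).
      apply Rmult_le_pos; [apply Rmult_le_pos|]; lra.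
  + assert (P b <= 0).
    { unfold P, Gamma_boundary; pose proof (Hpow b ltac:(lra)); pose proof (exp_pos (- b)).
      assert (Rpower b x * exp (- b) - (2 + b) * exp (- b) <= 0) by nra.
      nra. }
    assert (- P a <= 2 * / x).
    { unfold P, Gamma_boundary.
      (* From [1 + a <= exp a] follows [2 + a <= 2 * exp a]. *)
      assert (Ha : (2 + a) * exp (- a) <= 2).
      { pose proof (exp_ineq1_le a) as E; pose proof (exp_pos (- a)).
        assert (exp a * exp (- a) = 1)
          by (rewrite <- exp_plus, Rplus_opp_r, exp_0; reflexivity).
        nra. }
      assert (0 < Rpower a x * exp (- a)) by (apply Rmult_lt_0_compat; apply exp_pos).
      nra. }
    lra.
- exists l; split; [|exact Hl].
  apply Rlt_le_trans with (RInt (Gamma_integrand x) 1 2); [|apply Hle; lra].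
  apply RInt_gt_0; [lra|intros; apply Gamma_integrand_pos|].
  intros t Ht; apply Gamma_integrand_continuous; lra.
Qed.

(** Induction on an integer bound for the argument; the functional equation lifts existence from
    [y - 1] to [y]. *)
Lemma ex_Gamma (x : R) : 0 < x ->
  exists l, 0 < l /\
    is_RInt_gen (Gamma_integrand x) (at_right 0) (Rbar_locally p_infty) l.
Proof.
assert (H : forall n y, 0 < y <= INR n + 1 -> exists l, 0 < l /\
    is_RInt_gen (Gamma_integrand y) (at_right 0) (Rbar_locally p_infty) l).
{ induction n as [|n IH]; intros y Hy.
  - apply ex_Gamma_small; simpl in Hy; lra.
  - rewrite S_INR in Hy; destruct (Rle_lt_dec y 1) as [H1|H1];
      [apply ex_Gamma_small; lra|].
    destruct (IH (y - 1)) as (l & Hl & Hi); [lra|].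
    exists ((y - 1) * l); split; [apply Rmult_lt_0_compat; lra|].
    replace y with (y - 1 + 1) at 1 by ring.
    apply is_RInt_gen_Gamma_step; [lra|exact Hi]. }
intros Hx; destruct (INR_unbounded x) as [n Hn].
apply (H n); lra.
Qed.

Lemma is_RInt_gen_Gamma (x : R) : 0 < x ->
  is_RInt_gen (Gamma_integrand x) (at_right 0) (Rbar_locally p_infty) (Gamma x).
Proof.
intros Hx; apply (RInt_gen_correct (V := R_CompleteNormedModule)).
destruct (ex_Gamma x Hx) as (l & _ & Hl); exists l; exact Hl.
Qed.

Lemma Gamma_unique (x l : R) :
  is_RInt_gen (Gamma_integrand x) (at_right 0) (Rbar_locally p_infty) l -> Gamma x = l.
Proof. apply (is_RInt_gen_unique (V := R_CompleteNormedModule)). Qed.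

Lemma Gamma_pos (x : R) : 0 < x -> 0 < Gamma x.
Proof.
intros Hx; destruct (ex_Gamma x Hx) as (l & Hl & Hi).
rewrite (Gamma_unique x l Hi); exact Hl.
Qed.

Lemma Gamma_succ (x : R) : 0 < x -> Gamma (x + 1) = x * Gamma x.
Proof.
intros Hx; apply Gamma_unique, is_RInt_gen_Gamma_step; [exact Hx|].
apply is_RInt_gen_Gamma, Hx.
Qed.

Lemma Gamma_1 : Gamma 1 = 1.
Proof.
apply Gamma_unique.
assert (HD : forall t, is_derive (fun t => - exp (- t)) t (exp (- t)))
  by (intros t; auto_derive; [trivial|ring]).
assert (Hc : forall t, continuous (fun t => exp (- t)) t).
{ intros t; apply (ex_derive_continuous (V := R_NormedModule)); auto_derive; trivial. }
apply (is_RInt_gen_pos_ext (Derive (fun t => - exp (- t)))).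
- intros t Ht; unfold Gamma_integrand.
  replace (Derive (fun t => - exp (- t)) t) with (exp (- t))
    by (symmetry; apply is_derive_unique, HD).
  rewrite Rminus_diag_eq, Rpower_O by trivial; ring.
- replace 1 with (0 - - 1) by ring; apply is_RInt_gen_Derive.
  + apply filter_prod_pos; intros t _; eexists; apply HD.
  + apply filter_prod_pos; intros t _.
    apply (continuous_ext (fun t => exp (- t))); [|apply Hc].
    intros u; symmetry; apply is_derive_unique, HD.
  + eapply filterlim_filter_le_1; [apply (filter_le_within (F := locally 0))|].
    replace (- 1) with (- exp (- 0)) by (rewrite Ropp_0, exp_0; reflexivity).
    apply (ex_derive_continuous (fun t => - exp (- t)) 0); auto_derive; trivial.
  + replace 0 with (- 0) by ring.
    apply (is_lim_opp (fun t => exp (- t)) p_infty 0).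
    apply (is_lim_comp exp Ropp p_infty 0 m_infty is_lim_exp_m).
    * apply (is_lim_opp (fun t => t) p_infty p_infty), is_lim_id.
    * exists 0; intros; discriminate.
Qed.

Lemma Gamma_fact (n : nat) : Gamma (INR n + 1) = INR (fact n).
Proof.
induction n as [|n IH].
- simpl; rewrite Rplus_0_l; exact Gamma_1.
- rewrite S_INR, Gamma_succ, IH, fact_simpl, mult_INR, S_INR; [ring|].
  pose proof (pos_INR n); lra.
Qed.

(** Weighted AM-GM is applied to [t / y] rather than [t]: the two resulting integrals are then
    [s * Gamma (y+1) / y] and [(1 - s) * Gamma y], which add up to [Gamma y]. *)
Lemma Gamma_add_le (y s : R) :
  0 < y -> 0 <= s <= 1 -> Gamma (y + s) <= Rpower y s * Gamma y.
Proof.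
intros Hy Hs.
set (g := fun t => plus (scal (Rpower y s * s / y) (Gamma_integrand (y + 1) t))
  (scal (Rpower y s * (1 - s)) (Gamma_integrand y t))).
apply (is_RInt_gen_le (Gamma_integrand (y + s)) g).
- intros t Ht; split; [apply Rlt_le, Gamma_integrand_pos|].
  unfold g, plus, scal; simpl; unfold mult; simpl; unfold Gamma_integrand.
  assert (Hty : 0 < t / y) by (apply Rdiv_lt_0_compat; lra).
  replace (y + s - 1) with (s + (y - 1)) by ring.
  replace (y + 1 - 1) with (1 + (y - 1)) by ring.
  rewrite !Rpower_plus, Rpower_1 by lra.
  replace (Rpower t s) with (Rpower y s * Rpower (t / y) s).
  2: { rewrite Rpower_mult_distr by lra; f_equal; field; lra. }
  pose proof (Rpower_le_affine (t / y) s Hty Hs).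
  apply Rle_trans with (Rpower y s * (s * (t / y) + (1 - s))
    * Rpower t (y - 1) * exp (- t)).
  + apply Rmult_le_compat_r; [apply Rlt_le, exp_pos|].
    apply Rmult_le_compat_r; [apply Rlt_le, exp_pos|].
    apply Rmult_le_compat_l; [apply Rlt_le, exp_pos|assumption].
  + right; field; lra.
- apply is_RInt_gen_Gamma; lra.
- replace (Rpower y s * Gamma y) with
    (plus (scal (Rpower y s * s / y) (Gamma (y + 1))) (scal (Rpower y s * (1 - s)) (Gamma y))).
  + apply (is_RInt_gen_plus (V := R_NormedModule));
    apply (is_RInt_gen_scal (V := R_NormedModule)), is_RInt_gen_Gamma; lra.
  + unfold plus, scal; simpl; unfold mult; simpl.
    rewrite Gamma_succ by exact Hy; field; lra.
Qed.

(** * Gauss's limit and its derivatives *)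

Lemma is_lim_seq_inv_succ : is_lim_seq (fun n => / (INR n + 1)) 0.
Proof.
replace (Finite 0) with (Rbar_inv p_infty) by reflexivity.
apply is_lim_seq_inv; [|discriminate].
apply (is_lim_seq_ext (fun n => INR (S n))); [intros; apply S_INR|].
apply is_lim_seq_incr_1 with (u := INR), is_lim_seq_INR.
Qed.

(** The step bounds telescope to [K / (n+1)], giving a Cauchy sequence and an explicit tail. When
    [K] does not depend on a parameter, the tail bound is a uniform one. *)
Lemma telescoping_bound_lim (u : nat -> R) (K : R) :
  (forall n, Rabs (u (S n) - u n) <= K * (/ (INR n + 1) - / (INR n + 2))) ->
  is_lim_seq u (real (Lim_seq u)) /\
  forall n, Rabs (Lim_seq u - u n) <= K * / (INR n + 1).
Proof.
intros Hu.
assert (Hdiff : forall n m,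
  Rabs (u (n + m)%nat - u n) <= K * (/ (INR n + 1) - / (INR (n + m) + 1))).
{ intros n m; induction m as [|m IH].
  - rewrite Nat.add_0_r, Rminus_diag_eq, Rabs_R0 by reflexivity; lra.
  - rewrite Nat.add_succ_r, S_INR.
    replace (u (S (n + m)) - u n) with (u (S (n + m)) - u (n + m)%nat + (u (n + m)%nat - u n)) by ring.
    eapply Rle_trans; [apply Rabs_triang|].
    specialize (Hu (n + m)%nat).
    replace (INR (n + m) + 1 + 1) with (INR (n + m) + 2) by ring; lra. }
(* At [n = 0] the hypothesis bounds an absolute value by [K / 2]. *)
assert (HK : 0 <= K).
{ pose proof (Hu 0%nat) as H; pose proof (Rabs_pos (u 1%nat - u 0%nat)).
  simpl in H; lra. }
assert (Hdiff' : forall n m, (n <= m)%nat -> Rabs (u m - u n) <= K * / (INR n + 1)).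
{ intros n m Hnm; replace m with (n + (m - n))%nat by lia.
  eapply Rle_trans; [apply Hdiff|].
  apply Rmult_le_compat_l; [exact HK|].
  assert (0 < / (INR (n + (m - n)) + 1)); [|lra].
  apply Rinv_0_lt_compat; pose proof (pos_INR (n + (m - n))); lra. }
assert (H0 : is_lim_seq (fun n => K * / (INR n + 1)) 0).
{ replace (Finite 0) with (Finite (K * 0)) by (f_equal; ring).
  apply (is_lim_seq_scal_l _ _ 0), is_lim_seq_inv_succ. }
assert (Hex : ex_finite_lim_seq u).
{ apply ex_lim_seq_cauchy_corr; intros eps.
  apply is_lim_seq_spec in H0; destruct (H0 (pos_div_2 eps)) as [N HN].
  exists N; intros n m Hn Hm.
  specialize (HN N (le_n N)); apply Rabs_lt_between in HN; simpl in HN.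
  pose proof (Hdiff' N n Hn); pose proof (Hdiff' N m Hm).
  replace (u n - u m) with (u n - u N - (u m - u N)) by ring.
  eapply Rle_lt_trans; [apply Rabs_triang|]; rewrite Rabs_Ropp; lra. }
assert (Hlim : is_lim_seq u (real (Lim_seq u))) by (apply Lim_seq_correct', Hex).
split; [exact Hlim|]; intros n.
apply (is_lim_seq_le_loc (fun m => Rabs (u m - u n)) (fun _ => K * / (INR n + 1))
  (Rabs (Lim_seq u - u n)) (K * / (INR n + 1))).
- exists n; intros m Hm; apply Hdiff', Hm.
- apply (is_lim_seq_abs _ (Lim_seq u - u n)).
  apply is_lim_seq_minus'; [exact Hlim|apply is_lim_seq_const].
- apply is_lim_seq_const.
Qed.

(** Termwise differentiation under locally uniform convergence of the derivatives. It is applied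
    twice, from [ln Gamma] to digamma and from digamma to trigamma. *)
Lemma is_derive_telescoping_lim (h h' : nat -> R -> R) (F : R -> R) :
  (forall n y, 0 < y -> is_derive (h n) y (h' n y)) ->
  (forall n y, 0 < y -> continuous (h' n) y) ->
  (forall y, 0 < y -> is_lim_seq (fun n => h n y) (F y)) ->
  (forall Y, exists K, forall n y, 0 < y < Y ->
     Rabs (h' (S n) y - h' n y) <= K * (/ (INR n + 1) - / (INR n + 2))) ->
  forall x, 0 < x ->
    is_lim_seq (fun n => h' n x) (real (Lim_seq (fun n => h' n x))) /\
    is_derive F x (real (Lim_seq (fun n => h' n x))).
Proof.
intros Hd Hc Hl Ht x Hx.
(* The ball of radius [x] about [x] is the interval from 0 to [x + x]. *)
destruct (Ht (x + x)) as [K HK].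
split; [apply (telescoping_bound_lim _ K); intros n; apply HK; lra|].
assert (Hball : forall y, Boule x (mkposreal x Hx) y -> 0 < y < x + x).
{ intros y Hy; apply Rabs_lt_between' in Hy; simpl in Hy; lra. }
assert (Hcvu : CVU h' (fun y => Lim_seq (fun n => h' n y)) x (mkposreal x Hx)).
{ intros eps Heps.
  assert (H0 : is_lim_seq (fun n => K * / (INR n + 1)) 0).
  { replace (Finite 0) with (Finite (K * 0)) by (f_equal; ring).
    apply (is_lim_seq_scal_l _ _ 0), is_lim_seq_inv_succ. }
  apply is_lim_seq_spec in H0; destruct (H0 (mkposreal eps Heps)) as [N HN].
  exists N; intros n y Hn Hy; apply Hball in Hy.
  eapply Rle_lt_trans.
  - apply (telescoping_bound_lim (fun n => h' n y) K); intros k; apply HK, Hy.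
  - specialize (HN n Hn); apply Rabs_lt_between in HN; simpl in HN; lra. }
apply is_derive_Reals.
apply (derivable_pt_lim_CVU h h' F (fun y => Lim_seq (fun n => h' n y)) x x
  (mkposreal x Hx)).
- unfold Boule; rewrite Rminus_diag_eq, Rabs_R0 by reflexivity; exact Hx.
- intros y n Hy; apply is_derive_Reals, Hd, Hball, Hy.
- intros y Hy; apply is_lim_seq_Reals, Hl, Hball, Hy.
- exact Hcvu.
- apply (CVU_continuity h'); [exact Hcvu|].
  intros n y Hy; apply continuity_pt_filterlim, Hc, Hball, Hy.
Qed.
(** The logarithm of Gauss's product [(n+1)^x n! / (x (x+1) ... (x+n))]; the base [n + 1] instead of
    [n] keeps the logarithm meaningful at [n = 0]. *)
Definition log_gauss (n : nat) (x : R) : R :=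
  x * ln (INR n + 1) + ln (INR (fact n)) - sum_f_R0 (fun k => ln (x + INR k)) n.

Lemma ln_succ_diff_le (x p : R) : 0 <= x -> 0 < p -> 0 <= ln (p + x) - ln p <= x / p.
Proof.
intros Hx Hp; split.
- pose proof (ln_le p (p + x) Hp); lra.
- rewrite <- ln_div by lra.
  pose proof (exp_ineq1_le (ln ((p + x) / p))) as E.
  rewrite exp_ln in E by (apply Rdiv_lt_0_compat; lra).
  replace ((p + x) / p) with (1 + x / p) in E |- * by (field; lra); lra.
Qed.

Lemma ln_Gamma_add_nat (x : R) (n : nat) : 0 < x ->
  ln (Gamma (INR n + 1 + x)) = ln (Gamma x) + sum_f_R0 (fun k => ln (x + INR k)) n.
Proof.
intros Hx; induction n as [|n IH].
- simpl; replace (0 + 1 + x) with (x + 1) by ring.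
  rewrite Gamma_succ, ln_mult, Rplus_0_r by (try apply Gamma_pos; exact Hx); ring.
- pose proof (pos_INR n); rewrite tech5, S_INR.
  replace (INR n + 1 + 1 + x) with (INR n + 1 + x + 1) by ring.
  rewrite Gamma_succ, ln_mult, IH by (try apply Gamma_pos; lra).
  replace (INR n + 1 + x) with (x + (INR n + 1)) by ring; ring.
Qed.

Lemma ln_Rpower (x y : R) : ln (Rpower x y) = y * ln x.
Proof. unfold Rpower; apply ln_exp. Qed.

(** [Gamma_add_le] is used at [n+1] with exponent [x], and at [n+1+x] with exponent [1-x]. The error
    then lies between 0 and [(1-x) * (ln (n+1+x) - ln (n+1))]. *)
Lemma log_gauss_small (n : nat) (x : R) : 0 < x <= 1 ->
  Rabs (log_gauss n x - ln (Gamma x)) <= 1 / (INR n + 1).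
Proof.
intros Hx; pose proof (pos_INR n).
pose proof (ln_Gamma_add_nat x n ltac:(lra)) as E.
pose proof (Gamma_pos (INR n + 1 + x) ltac:(lra)).
pose proof (INR_fact_lt_0 n).
assert (Hup : ln (Gamma (INR n + 1 + x)) <= x * ln (INR n + 1) + ln (INR (fact n))).
{ rewrite <- ln_Rpower, <- Gamma_fact, <- ln_mult;
    [|apply exp_pos|apply Gamma_pos; lra].
  apply ln_le; [assumption|]; apply Gamma_add_le; lra. }
assert (Hlo : ln (INR n + 1) + ln (INR (fact n))
  <= (1 - x) * ln (INR n + 1 + x) + ln (Gamma (INR n + 1 + x))).
{ rewrite <- ln_Rpower, <- (ln_mult (Rpower _ _)), <- ln_mult by (try apply exp_pos; lra).
  rewrite <- Gamma_fact, <- Gamma_succ by lra.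
  apply ln_le; [apply Gamma_pos; lra|].
  replace (INR n + 1 + 1) with (INR n + 1 + x + (1 - x)) by ring.
  apply Gamma_add_le; lra. }
pose proof (ln_succ_diff_le x (INR n + 1) ltac:(lra) ltac:(lra)) as [Hd1 Hd2].
assert (x / (INR n + 1) <= 1 / (INR n + 1)).
{ apply Rmult_le_compat_r; [apply Rlt_le, Rinv_0_lt_compat; lra|lra]. }
unfold log_gauss; apply Rabs_le; nra.
Qed.

(** The shifted sum of logarithms differs only in its end terms. Up to a vanishing error this is the
    functional equation of [ln Gamma]. *)
Lemma log_gauss_succ (n : nat) (x : R) : 0 < x ->
  log_gauss n (x + 1)
  = log_gauss n x + ln x - (ln (INR n + 1 + x) - ln (INR n + 1)).
Proof.
intros Hx; unfold log_gauss.
assert (E : sum_f_R0 (fun k => ln (x + 1 + INR k)) n + ln x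
  = sum_f_R0 (fun k => ln (x + INR k)) n + ln (INR n + 1 + x)).
{ pose proof (sum_f_R0_telescope (fun k => ln (x + INR k)) n) as T.
  rewrite minus_sum in T.
  rewrite (sum_eq _ (fun k => ln (x + INR (S k))))
    by (intros; rewrite S_INR; f_equal; ring).
  rewrite S_INR in T; simpl (INR 0) in T; rewrite Rplus_0_r in T.
  replace (INR n + 1 + x) with (x + (INR n + 1)) by ring; lra. }
lra.
Qed.

Lemma log_gauss_error (x : R) : 0 < x -> exists K, forall n,
  Rabs (log_gauss n x - ln (Gamma x)) <= K / (INR n + 1).
Proof.
assert (H : forall m y, 0 < y <= INR m + 1 -> exists K, forall n,
  Rabs (log_gauss n y - ln (Gamma y)) <= K / (INR n + 1)).
{ induction m as [|m IH]; intros y Hy.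
  - exists 1; intros n; apply log_gauss_small; simpl in Hy; lra.
  - rewrite S_INR in Hy; destruct (Rle_lt_dec y 1) as [H1|H1];
      [exists 1; intros n; apply log_gauss_small; lra|].
    destruct (IH (y - 1)) as [K HK]; [lra|].
    (* The shift from [y - 1] to [y] adds an error of at most [(y - 1) / (n + 1)]. *)
    exists (K + (y - 1)); intros n; pose proof (pos_INR n).
    replace y with (y - 1 + 1) at 1 2 by ring.
    rewrite log_gauss_succ, Gamma_succ, ln_mult by (try apply Gamma_pos; lra).
    pose proof (ln_succ_diff_le (y - 1) (INR n + 1) ltac:(lra) ltac:(lra)) as [Hd1 Hd2].
    pose proof (HK n) as Hn; apply Rabs_le_between in Hn.
    unfold Rdiv in *; rewrite Rmult_plus_distr_r; apply Rabs_le; lra. }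
intros Hx; destruct (INR_unbounded x) as [m Hm]; apply (H m); lra.
Qed.

Lemma log_gauss_lim (x : R) : 0 < x ->
  is_lim_seq (fun n => log_gauss n x) (ln (Gamma x)).
Proof.
intros Hx; destruct (log_gauss_error x Hx) as [K HK].
apply (is_lim_seq_le_le (fun n => ln (Gamma x) - K * / (INR n + 1)) _
  (fun n => ln (Gamma x) + K * / (INR n + 1))).
- intros n; pose proof (HK n) as H; apply Rabs_le_between in H; unfold Rdiv in H; lra.
- replace (Finite (ln (Gamma x))) with (Finite (ln (Gamma x) - K * 0)) by (f_equal; ring).
  apply is_lim_seq_minus'; [apply is_lim_seq_const|].
  apply (is_lim_seq_scal_l _ _ 0), is_lim_seq_inv_succ.
- replace (Finite (ln (Gamma x))) with (Finite (ln (Gamma x) + K * 0)) by (f_equal; ring).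
  apply is_lim_seq_plus'; [apply is_lim_seq_const|].
  apply (is_lim_seq_scal_l _ _ 0), is_lim_seq_inv_succ.
Qed.

Definition digamma_gauss (n : nat) (x : R) : R :=
  ln (INR n + 1) - sum_f_R0 (fun k => / (x + INR k)) n.

Definition trigamma_gauss (n : nat) (x : R) : R :=
  sum_f_R0 (fun k => / (x + INR k) ^ 2) n.

Lemma is_derive_sum_f_R0 (f : nat -> R -> R) (df : nat -> R) (x : R) (n : nat) :
  (forall k, is_derive (f k) x (df k)) ->
  is_derive (fun y => sum_f_R0 (fun k => f k y) n) x (sum_f_R0 df n).
Proof.
intros Hf; induction n as [|n IH]; simpl; [apply Hf|].
apply (is_derive_plus (V := R_NormedModule)); [exact IH|apply Hf].
Qed.

Lemma log_gauss_derive (n : nat) (x : R) :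
  0 < x -> is_derive (log_gauss n) x (digamma_gauss n x).
Proof.
intros Hx; unfold log_gauss, digamma_gauss.
apply (is_derive_minus (V := R_NormedModule)).
- auto_derive; [trivial|ring].
- apply is_derive_sum_f_R0 with (f := fun k y => ln (y + INR k)); intros k.
  pose proof (pos_INR k); auto_derive; [lra|field; lra].
Qed.

Lemma digamma_gauss_derive (n : nat) (x : R) :
  0 < x -> is_derive (digamma_gauss n) x (trigamma_gauss n x).
Proof.
intros Hx; unfold trigamma_gauss, digamma_gauss.
replace (sum_f_R0 (fun k => / (x + INR k) ^ 2) n)
  with (0 - sum_f_R0 (fun k => - / (x + INR k) ^ 2) n).
- apply (is_derive_minus (V := R_NormedModule)); [auto_derive; [trivial|ring]|].
  apply is_derive_sum_f_R0 with (f := fun k y => / (y + INR k)); intros k.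
  pose proof (pos_INR k); auto_derive; [lra|field; lra].
- rewrite (sum_eq _ (fun k => / (x + INR k) ^ 2 * - 1)) by (intros; ring).
  rewrite <- scal_sum; ring.
Qed.

Lemma trigamma_gauss_continuous (n : nat) (x : R) :
  0 < x -> continuous (trigamma_gauss n) x.
Proof.
intros Hx; apply (ex_derive_continuous (V := R_NormedModule)); eexists.
apply (is_derive_sum_f_R0 (fun k y => / (y + INR k) ^ 2)
  (fun k => - 2 / (x + INR k) ^ 3)); intros k.
pose proof (pos_INR k); auto_derive; [|field; lra].
apply Rgt_not_eq; pose proof (pow_lt (x + INR k) 2); simpl in *; lra.
Qed.

(** With [p = n + 1] the difference is [ln (p+1) - ln p - 1/(x+p)], where the logarithmic part lies
    between [1/(p+1)] and [1/p]. The bound [x < Y] makes the constant uniform. *)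
Lemma digamma_gauss_step (n : nat) (x Y : R) : 0 < x < Y ->
  Rabs (digamma_gauss (S n) x - digamma_gauss n x)
  <= (2 * Y + 1) * (/ (INR n + 1) - / (INR n + 2)).
Proof.
intros Hx; unfold digamma_gauss; rewrite tech5, S_INR.
set (p := INR n + 1); replace (INR n + 2) with (p + 1) by (unfold p; ring).
assert (Hp : 1 <= p) by (pose proof (pos_INR n); unfold p; lra).
pose proof (ln_succ_diff_le 1 p ltac:(lra) ltac:(lra)) as [_ H1].
assert (H2 : / (p + 1) <= ln (p + 1) - ln p).
{ rewrite <- ln_div by lra.
  replace ((p + 1) / p) with (/ (p / (p + 1))) by (field; lra).
  assert (Hq : 0 < p / (p + 1)) by (apply Rdiv_lt_0_compat; lra).
  rewrite ln_Rinv by exact Hq.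
  pose proof (exp_ineq1_le (ln (p / (p + 1)))) as E; rewrite exp_ln in E by exact Hq.
  replace (p / (p + 1)) with (1 - / (p + 1)) in E at 2 by (field; lra); lra. }
assert (H3 : / (x + p) <= / p) by (apply Rinv_le_contravar; lra).
(* Uses [(p + 1) / 2 <= p <= x + p], valid as [p >= 1]. *)
assert (H4 : / p - / (x + p) <= 2 * x * (/ p - / (p + 1))).
{ replace (/ p - / (x + p)) with (x / (p * (x + p))) by (field; lra).
  replace (2 * x * (/ p - / (p + 1))) with (x / (p * ((p + 1) / 2))) by (field; lra).
  apply Rmult_le_compat_l; [lra|].
  apply Rinv_le_contravar; nra. }
assert (H5 : 0 < / p - / (p + 1)).
{ replace (/ p - / (p + 1)) with (/ (p * (p + 1))) by (field; lra).
  apply Rinv_0_lt_compat; nra. }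
assert (2 * x * (/ p - / (p + 1)) <= 2 * Y * (/ p - / (p + 1)))
  by (apply Rmult_le_compat_r; lra).
unfold Rdiv in H1; apply Rabs_le; lra.
Qed.

Lemma trigamma_gauss_step (n : nat) (x : R) : 0 < x ->
  Rabs (trigamma_gauss (S n) x - trigamma_gauss n x)
  <= 2 * (/ (INR n + 1) - / (INR n + 2)).
Proof.
intros Hx; unfold trigamma_gauss; rewrite tech5, S_INR.
pose proof (pos_INR n).
replace (2 * (/ (INR n + 1) - / (INR n + 2)))
  with (/ ((INR n + 1) * ((INR n + 2) / 2))) by (field; lra).
match goal with |- Rabs ?e <= _ => replace e with (/ (x + (INR n + 1)) ^ 2) by ring end.
rewrite Rabs_pos_eq.
- apply Rinv_le_contravar; nra.
- apply Rlt_le, Rinv_0_lt_compat, pow_lt; lra.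
Qed.

Lemma digamma_lim (x : R) : 0 < x ->
  is_lim_seq (fun n => digamma_gauss n x) (digamma x).
Proof.
intros Hx.
destruct (is_derive_telescoping_lim log_gauss digamma_gauss (fun y => ln (Gamma y)))
  with (x := x) as [Hl Hd]; trivial.
- exact log_gauss_derive.
- intros n y Hy; apply (ex_derive_continuous (V := R_NormedModule)); eexists.
  apply digamma_gauss_derive, Hy.
- exact log_gauss_lim.
- intros Y; exists (2 * Y + 1); intros n y; apply digamma_gauss_step.
- unfold digamma; rewrite (is_derive_unique _ _ _ Hd); exact Hl.
Qed.

Lemma trigamma_lim (x : R) : 0 < x ->
  is_lim_seq (fun n => sum_f_R0 (fun k => / (x + INR k) ^ 2) n) (trigamma x).
Proof.
intros Hx.
destruct (is_derive_telescoping_lim digamma_gauss trigamma_gauss digamma)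
  with (x := x) as [Hl Hd]; trivial.
- exact digamma_gauss_derive.
- exact trigamma_gauss_continuous.
- intros y Hy; apply digamma_lim, Hy.
- intros Y; exists 2; intros n y Hy; apply trigamma_gauss_step, Hy.
- unfold trigamma; rewrite (is_derive_unique _ _ _ Hd); exact Hl.
Qed.

(** * Trigamma at half-integers and the three identities *)

(** As [1 / (n + 3/2 + k)^2 = 4 / (2 (n+1+k) + 1)^2], a quarter of the trigamma value is the tail,
    from index [n + 1], of the series with sum [PI^2 / 8]. *)
Lemma trigamma_half_odd (n : nat) :
  PI ^ 2 - 2 * trigamma (INR n + 3 / 2) = 8 * odd_inv_sq n.
Proof.
pose proof (pos_INR n) as Hn.
pose proof (trigamma_lim (INR n + 3 / 2) ltac:(lra)) as H.
assert (Hs : forall N, odd_inv_sq (N + S n)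
  = / 4 * sum_f_R0 (fun k => / (INR n + 3 / 2 + INR k) ^ 2) N + odd_inv_sq n).
{ intros N; unfold odd_inv_sq.
  rewrite (tech2 _ n (N + S n)) by lia.
  replace (N + S n - S n)%nat with N by lia.
  rewrite Rplus_comm; f_equal; rewrite scal_sum; apply sum_eq; intros k _.
  rewrite plus_INR, S_INR; pose proof (pos_INR k); field; lra. }
assert (Hl : is_lim_seq odd_inv_sq (/ 4 * trigamma (INR n + 3 / 2) + odd_inv_sq n)).
{ apply (is_lim_seq_incr_n _ (S n)).
  apply (is_lim_seq_ext _ _ _ (fun N => eq_sym (Hs N))).
  apply is_lim_seq_plus'; [|apply is_lim_seq_const].
  apply (is_lim_seq_scal_l _ _ (trigamma (INR n + 3 / 2))), H. }
apply odd_inv_sq_lim in Hl; lra.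
Qed.

Lemma pow2_double (n : nat) : 2 ^ (2 * n + 3) = 2 * 4 ^ (n + 1).
Proof.
replace (2 * n + 3)%nat with (1 + 2 * (n + 1))%nat by lia.
rewrite pow_add, pow_mult; replace (2 ^ 2) with 4 by ring; ring.
Qed.

(* Binomial.C is Stdlib's real-valued binomial coefficient; sum_f_R0 f n
   sums f over 0 <= k <= n, both bounds included. *)
Theorem theorem3p1 (n : nat) :
  sum_f_R0 (fun k : nat =>
      1 / (2 ^ (4 * k) * INR (2 * k + 1) * INR (n - k + 1) ^ 2)
      * (Binomial.C (2 * k) k / Binomial.C (2 * (n - k + 1)) (n - k + 1))) n
    = 3 * INR (double_fact (2 * n + 1)) ^ 2
        / (2 ^ (2 * n + 3) * INR (fact (2 * n + 3)))
      * (PI ^ 2 - 2 * trigamma (INR n + 3 / 2))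
  /\
  sum_f_R0 (fun k : nat =>
      1 / (2 ^ (4 * k) * INR (n - k + 1) ^ 2)
      * (Binomial.C (2 * k) k / Binomial.C (2 * (n - k + 1)) (n - k + 1))) n
    = INR (double_fact (2 * n + 1)) ^ 2
        / (2 ^ (2 * n + 3) * INR (fact (2 * n + 2)))
      * (PI ^ 2 - 2 * trigamma (INR n + 3 / 2))
  /\
  sum_f_R0 (fun k : nat =>
      1 / (2 ^ (4 * k) * INR (2 * k + 1) * INR (n - k + 1))
      * (Binomial.C (2 * k) k / Binomial.C (2 * (n - k + 1)) (n - k + 1))) n
    = INR (double_fact (2 * n + 1)) ^ 2
        / (2 ^ (2 * n + 3) * INR (fact (2 * n + 2)))
      * (PI ^ 2 - 2 * trigamma (INR n + 3 / 2)).
Proof.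
rewrite trigamma_half_odd, pow2_double.
pose proof (pow_lt 4 (n + 1) ltac:(lra)).
pose proof (INR_fact_lt_0 (2 * n + 2)); pose proof (INR_fact_lt_0 (2 * n + 3)).
assert (Hodd : forall k, INR (2 * k + 1) = 2 * INR k + 1)
  by (intros; rewrite plus_INR, mult_INR; reflexivity).
assert (H2 : forall k, 0 < 2 ^ k) by (intros; apply pow_lt; lra).
(* Since [asin2 m] already carries [1 / m^2], the three sums have weights [1 / (2k+1)], 1 and
   [m / (2k+1)]. *)
split; [|split].
- rewrite (sum_conv (fun k _ => / (2 * INR k + 1))
    (fun k m => 1 / (2 ^ (4 * k) * INR (2 * k + 1) * INR m ^ 2))).
  + rewrite conv_inv_closed_form; field; lra.
  + intros k m Hm; rewrite Hodd; apply lt_0_INR in Hm.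
    pose proof (pos_INR k); specialize (H2 (4 * k)%nat); field; lra.
- rewrite (sum_conv (fun _ _ => 1) (fun k m => 1 / (2 ^ (4 * k) * INR m ^ 2))).
  + rewrite conv_const_closed_form; field; lra.
  + reflexivity.
- rewrite (sum_conv (fun k m => INR m / (2 * INR k + 1))
    (fun k m => 1 / (2 ^ (4 * k) * INR (2 * k + 1) * INR m))).
  + rewrite conv_ratio_closed_form; field; lra.
  + intros k m Hm; rewrite Hodd; apply lt_0_INR in Hm.
    pose proof (pos_INR k); specialize (H2 (4 * k)%nat); field; lra.
Qed.
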